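(* Let $A$ be a nonsingular $3\times3$ real matrix on $S^8(\sqrt3)$ lying in the open tubular neighborhood $N$ of $SO(3)$. Then the nearest orthogonal neighbor to $A$ on $S^8(\sqrt3)$ is the center of the cross-sectional fibre of $N$ on which $A$ lies.
   Context: Real $3\times3$ matrices are identified with points of $\mathbb{R}^9$ with the Euclidean inner product $\langle A,B\rangle=\operatorname{tr}(A^TB)$, and $S^8(\sqrt3)$ is the round sphere of matrices of norm $\sqrt3$ with its geodesic (great circle) distance; it contains the orthogonal group $O(3)$. $D^5$ is the set of symmetric positive definite matrices on $S^8(\sqrt3)$, an open $5$-cell with center the identity $I$. The tubular neighborhood $N$ of $SO(3)$ is $N=\bigcup_{U\in SO(3)}UD^5$ (the set of matrices of positive determinant on $S^8(\sqrt3)$); its cross-sectional fibres are the pairwise disjoint cells $UD^5=\{UP:P\in D^5\}$, $U\in SO(3)$, and the center of $UD^5$ is $U$. The nearest orthogonal neighbor to $A$ is the element of $O(3)$ at least distance from $A$ on $S^8(\sqrt3)$. *)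

(* Defs.v *)
From HB Require Import structures.
From mathcomp Require Import all_boot all_order all_algebra.
From mathcomp Require Import all_classical all_reals all_analysis.

Set Implicit Arguments.
Unset Strict Implicit.
Unset Printing Implicit Defensive.

Import Order.TTheory GRing.Theory Num.Theory.
Local Open Scope classical_set_scope.
Local Open Scope ring_scope.

(* The library norm `|A| on matrices is the sup norm, hence the explicit
   Euclidean inner product and norm on 'M_3 seen as R^9. *)
Definition inner (R : realType) (A B : 'M[R]_3) : R := \tr (A^T *m B).

Definition enorm (R : realType) (A : 'M[R]_3) : R := Num.sqrt (inner A A).

Definition S8 (R : realType) : set 'M[R]_3 :=
  [set A | enorm A = Num.sqrt 3].

(* Great-circle distance on the sphere of radius sqrt 3: radius times the
   angle between the two points; meaningful for A, B in S8 only. *)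
Definition geodist (R : realType) (A B : 'M[R]_3) : R :=
  Num.sqrt 3 * acos (inner A B / (enorm A * enorm B)).

Definition O3 (R : realType) : set 'M[R]_3 := [set U | U^T *m U = 1%:M].

Definition SO3 (R : realType) : set 'M[R]_3 := [set U | O3 U /\ \det U = 1].

Definition posdef (R : realType) (P : 'M[R]_3) : Prop :=
  forall x : 'cV[R]_3, x != 0 -> 0 < (x^T *m P *m x) 0 0.

Definition D5 (R : realType) : set 'M[R]_3 :=
  [set P | [/\ P \is symmetricmx, posdef P & S8 P]].

(* For U in SO3, the cross-sectional fibre U D5 of N; its center is U, the
   image of the center 1%:M of D5 under left multiplication by U. *)
Definition fibre (R : realType) (U : 'M[R]_3) : set 'M[R]_3 :=
  [set U *m P | P in @D5 R].

Definition tubularN (R : realType) : set 'M[R]_3 :=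
  \bigcup_(U in @SO3 R) fibre U.

(* The set of all minimizers: "the nearest orthogonal neighbor to A is U"
   reads [nearest_orthogonal A = [set U]]. *)
Definition nearest_orthogonal (R : realType) (A : 'M[R]_3) : set 'M[R]_3 :=
  [set V | O3 V /\ forall W, O3 W -> geodist A V <= geodist A W].

(* Main.v *)
Require Import Defs.
From mathcomp Require Import all_boot all_order all_algebra.
From mathcomp Require Import all_classical all_reals all_analysis.
From mathcomp Require Import ring lra.

Set Implicit Arguments.
Unset Strict Implicit.
Unset Printing Implicit Defensive.

Import Order.TTheory GRing.Theory Num.Theory.
Local Open Scope classical_set_scope.
Local Open Scope ring_scope.

(** Write A = U P with U orthogonal and P symmetric positive definite, and let
    W be any orthogonal matrix.  On the sphere, the great-circle distance is a
    decreasing function of the inner product (ler_geodist), so W is at least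
    distance from A exactly when it maximizes <A, W>.  The maximum is found
    without diagonalizing P, by completing the square (inner_gap):

      tr ((W - U) P (W - U)^T) = 2 (<A, U> - <A, W>).

    The left-hand side is the sum of the values of the quadratic form P on the
    rows of W - U, hence nonnegative, and it vanishes only if W = U
    (posdef_trace_ge0, posdef_trace_eq0).  So U is the unique maximizer over
    the whole group O(3), reflections included.

    The disjointness of the fibres then comes for free: if A lies on the fibres
    of both U and V, the same set of nearest neighbors is the singleton of U
    and the singleton of V. *)

Lemma innerC (R : realType) (A B : 'M[R]_3) : inner A B = inner B A.
Proof. by rewrite /inner -mxtrace_tr trmx_mul trmxK. Qed.

Lemma innerBl (R : realType) (A B C : 'M[R]_3) :
  inner (A - B) C = inner A C - inner B C.
Proof. by rewrite /inner raddfB /= mulmxBl raddfB. Qed.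

Lemma innerBr (R : realType) (A B C : 'M[R]_3) :
  inner C (A - B) = inner C A - inner C B.
Proof. by rewrite innerC innerBl !(innerC C). Qed.

Lemma innerNr (R : realType) (A B : 'M[R]_3) : inner A (- B) = - inner A B.
Proof. by rewrite /inner mulmxN raddfN. Qed.

Lemma inner_ge0 (R : realType) (A : 'M[R]_3) : 0 <= inner A A.
Proof.
rewrite /inner /mxtrace; apply: sumr_ge0 => i _; rewrite mxE.
by apply: sumr_ge0 => j _; rewrite mxE -expr2 sqr_ge0.
Qed.

Lemma S8_inner (R : realType) (A : 'M[R]_3) : S8 A -> inner A A = 3.
Proof.
by move=> SA; rewrite -[LHS]sqr_sqrtr ?inner_ge0// -/(enorm A) SA sqr_sqrtr.
Qed.

Lemma O3_S8 (R : realType) (W : 'M[R]_3) : O3 W -> S8 W.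
Proof. by rewrite /S8 /= /enorm /inner => ->; rewrite mxtrace1. Qed.

Lemma O3N (R : realType) (W : 'M[R]_3) : O3 W -> O3 (- W).
Proof. by rewrite /O3 /= [(- W)^T]raddfN /= mulNmx mulmxN opprK. Qed.

Lemma symmetricmx_tr (R : realType) (P : 'M[R]_3) :
  P \is symmetricmx -> P^T = P.
Proof.
by move/is_hermitianmxP; rewrite expr0 scale1r => e; rewrite [RHS]e map_mx_id.
Qed.

(** Cauchy-Schwarz on the sphere of radius sqrt 3, from
    0 <= <A - B, A - B> = 6 - 2 <A, B>. *)
Lemma S8_inner_le3 (R : realType) (A B : 'M[R]_3) :
  S8 A -> S8 B -> inner A B <= 3.
Proof.
move=> /S8_inner AA /S8_inner BB; have := inner_ge0 (A - B).
by rewrite innerBl !innerBr AA BB (innerC B A); lra.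
Qed.

(** The i-th diagonal entry of X P X^T is the quadratic form P evaluated at
    the i-th row of X; the equality case, summed over i, is what detects
    X = 0 from a single trace. *)
Lemma posdef_diag_leif (R : realType) (P : 'M[R]_3) (X : 'M[R]_3) i :
  posdef P -> 0 <= (X *m P *m X^T) i i ?= iff (row i X == 0).
Proof.
move=> Ppos.
have -> : (X *m P *m X^T) i i = (row i X *m P *m (row i X)^T) 0 0.
  by rewrite -row_mul !mxE; apply: eq_bigr => j _; rewrite !mxE.
case: eqP => [->|/eqP X0]; first by rewrite !mul0mx mxE; split; rewrite ?eqxx.
have /Ppos : (row i X)^T != 0 by rewrite -trmx0 (inj_eq trmx_inj).
by rewrite trmxK => h; split; [exact: ltW|rewrite lt_eqF].
Qed.

Lemma posdef_trace_ge0 (R : realType) (P X : 'M[R]_3) :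
  posdef P -> 0 <= \tr (X *m P *m X^T).
Proof.
by move=> Ppos; apply: sumr_ge0 => i _; case: (posdef_diag_leif X i Ppos).
Qed.

Lemma posdef_trace_eq0 (R : realType) (P X : 'M[R]_3) :
  posdef P -> \tr (X *m P *m X^T) = 0 -> X = 0.
Proof.
move=> Ppos /psumr_eq0P tr0; apply/row_matrixP => i; rewrite row0.
apply/eqP; have [_ <-] := posdef_diag_leif X i Ppos; rewrite tr0// => j _.
by case: (posdef_diag_leif X j Ppos).
Qed.

(** Expanding the trace, the two diagonal terms W P W^T and U P U^T are
    conjugates of P, so both have trace tr P = <U P, U>; by symmetry of P, the
    two cross terms are transposes of each other and both have trace
    <U P, W>. *)
Lemma inner_gap (R : realType) (U P W : 'M[R]_3) :
  P^T = P -> O3 U -> O3 W ->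
  \tr ((W - U) *m P *m (W - U)^T) = 2 * (inner (U *m P) U - inner (U *m P) W).
Proof.
move=> Psym OU OW.
have conj_tr V : O3 V -> \tr (V *m P *m V^T) = \tr P.
  by move=> OV; rewrite mxtrace_mulC mulmxA OV mul1mx.
have cross : \tr (U *m P *m W^T) = inner (U *m P) W.
  by rewrite innerC /inner mxtrace_mulC.
have cross' : \tr (W *m P *m U^T) = inner (U *m P) W.
  by rewrite -cross -mxtrace_tr !trmx_mul trmxK Psym mulmxA.
have -> : inner (U *m P) U = \tr P.
  by rewrite innerC /inner mulmxA OU mul1mx.
rewrite [(W - U)^T]raddfB /= !mulmxBl !mulmxBr !raddfB /= !conj_tr// cross cross'.
by ring.
Qed.

Lemma inner_fibre_le (R : realType) (A U W : 'M[R]_3) :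
  O3 U -> fibre U A -> O3 W -> inner A W <= inner A U.
Proof.
move=> OU [P [/symmetricmx_tr Psym Ppos _] <-] OW.
by have := posdef_trace_ge0 (W - U) Ppos; rewrite inner_gap//; lra.
Qed.

Lemma inner_fibre_eq (R : realType) (A U W : 'M[R]_3) :
  O3 U -> fibre U A -> O3 W -> inner A U <= inner A W -> W = U.
Proof.
move=> OU FA OW le_UW; have le_WU := inner_fibre_le OU FA OW.
case: FA le_UW le_WU => P [/symmetricmx_tr Psym Ppos _] <- le_UW le_WU.
apply/subr0_eq/(posdef_trace_eq0 Ppos).
by rewrite inner_gap//; lra.
Qed.

Lemma ler_acos (R : realType) (x y : R) :
  -1 <= x <= 1 -> -1 <= y <= 1 -> (acos x <= acos y) = (y <= x).
Proof.
move=> x1 y1; rewrite leNgt -ltr_cos ?in_itv/= ?acos_ge0 ?acos_lepi//.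
by rewrite !acosK ?in_itv// -leNgt.
Qed.

(** The function acos is decreasing on [-1, 1] only, so the normalized inner
    products must be known to lie there; the lower bound is the upper bound
    for the opposite orthogonal matrix. *)
Lemma ler_geodist (R : realType) (A V W : 'M[R]_3) :
  S8 A -> O3 V -> O3 W ->
  (geodist A V <= geodist A W) = (inner A W <= inner A V).
Proof.
move=> SA OV OW.
have bnd X : O3 X -> -1 <= inner A X / 3 <= 1.
  move=> OX; have := S8_inner_le3 SA (O3_S8 OX).
  by have := S8_inner_le3 SA (O3_S8 (O3N OX)); rewrite innerNr; lra.
have geoE X : O3 X -> geodist A X = Num.sqrt 3 * acos (inner A X / 3).
  by move=> /O3_S8 SX; rewrite /geodist SA SX -expr2 sqr_sqrtr.
rewrite !geoE// ler_pM2l ?sqrtr_gt0// ler_acos ?bnd//.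
by rewrite ler_pM2r// invr_gt0.
Qed.

Lemma nearest_orthogonal_fibre (R : realType) (A U : 'M[R]_3) :
  S8 A -> O3 U -> fibre U A -> nearest_orthogonal A = [set U].
Proof.
move=> SA OU FA; apply/seteqP; split=> [V [OV minV]|_ ->] /=.
  apply: (inner_fibre_eq OU FA OV).
  by rewrite -ler_geodist//; exact: minV.
by split=> // W OW; rewrite ler_geodist//; exact: inner_fibre_le OW.
Qed.

Theorem mainTheorem8 (R : realType) (A : 'M[R]_3)
    (A_unit : A \in unitmx) (A_sphere : S8 A) (A_N : tubularN A) :
  exists U : 'M[R]_3,
    [/\ SO3 U, fibre U A,
        forall V : 'M[R]_3, SO3 V -> fibre V A -> V = U
      & nearest_orthogonal A = [set U]].
Proof.
case: A_N => U SU FU; have near_U := nearest_orthogonal_fibre A_sphere SU.1 FU.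
exists U; split=> // V SV FV.
have : nearest_orthogonal A V.
  by rewrite (nearest_orthogonal_fibre A_sphere SV.1 FV).
by rewrite near_U.
Qed.
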